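(* Let $N\ge2$ and let $\mathbf{d}=(d_1,\ldots,d_N)$ and $\mathbf{r}=(r_0=1,r_1,\ldots,r_{N-1},r_N=1)$ be sequences of positive integers. Then the tensor train variety $\mathrm{TT}_{\mathbf{d},\mathbf{r}}$ is equal to a tree tensor network variety, $\mathrm{TT}_{\mathbf{d},\mathbf{r}}=\mathrm{TTN}_{\mathscr{T},\mathbf{V},\mathbf{r}}$, where: (1) $\mathscr{T}$ is the rooted tree with leaves $\mathscr{L}=\{\lambda_1,\ldots,\lambda_N\}$, internal nodes $\mathscr{N}=\{v_1=\rho,v_2,\ldots,v_N\}$ with root $\rho=v_1$, and edges $\{\lambda_i,v_i\}$ for $i=1,\ldots,N$ and $\{v_i,v_{i+1}\}$ for $i=1,\ldots,N-1$; (2) $V_{\lambda_i}=\mathbb{C}^{d_i}$ for $i=1,\ldots,N$; (3) the rank sequence of $\mathscr{T}$ is $r_{\lambda_i}=d_i$ for $i=1,\ldots,N$ and $r_{v_i}=r_{i-1}$ for $i=2,\ldots,N$ (with the convention $r_{v_1}=r_\rho=1$).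
   Context: The tensor train variety $\mathrm{TT}_{\mathbf{d},\mathbf{r}}\subseteq\mathbb{P}\big(\bigotimes_{i=1}^N\mathbb{C}^{d_i}\big)$ is the Zariski closure of the set of classes $[\psi]$ of nonzero tensors of the form $$\psi_{j_1\cdots j_N}=\sum_{\alpha_1=1}^{r_1}\cdots\sum_{\alpha_{N-1}=1}^{r_{N-1}}A^1_{j_1,\alpha_1}A^2_{j_2,\alpha_2,\alpha_1}\cdots A^{N-1}_{j_{N-1},\alpha_{N-1},\alpha_{N-2}}A^N_{j_N,\alpha_{N-1}},$$ where $A^i\in\mathbb{C}^{d_i}\otimes\mathbb{C}^{r_i}\otimes(\mathbb{C}^{r_{i-1}})^*$ are arbitrary (the one-dimensional factors for $r_0=r_N=1$ are omitted). For a rooted tree $\mathscr{T}$ with root $\rho$, leaves $\mathscr{L}$ (vertices without children), internal nodes $\mathscr{N}=\mathscr{T}\setminus\mathscr{L}$, children sets $\mathrm{ch}(v)$, spaces $V_\lambda=\mathbb{C}^{d_\lambda}$ ($\lambda\in\mathscr{L}$) and positive integers $(r_v)_{v\in\mathscr{T}\setminus\{\rho\}}$ with $r_\rho:=1$, the variety $\mathrm{TTN}_{\mathscr{T},\mathbf{V},\mathbf{r}}\subset\mathbb{P}(\bigotimes_{\lambda\in\mathscr{L}}V_\lambda)$ is the set of $[\psi]$ such that for each vertex $v\in\mathscr{T}$ there is a linear subspace $U_v$ with $\dim U_v\le r_v$ satisfying: $U_\lambda\subseteq V_\lambda$ for $\lambda\in\mathscr{L}$; $U_v\subseteq\bigotimes_{u\in\mathrm{ch}(v)}U_u$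 for $v\in\mathscr{N}$; and some representative $\psi$ of $[\psi]$ lies in $U_\rho$. *)

(* Defs.v *)
From HB Require Import structures.
From mathcomp Require Import all_boot all_order all_algebra.
From mathcomp Require Import mpoly complex.
From mathcomp Require Import classical_sets reals.

Set Implicit Arguments.
Unset Strict Implicit.
Unset Printing Implicit Defensive.

Import GRing.Theory.
Local Open Scope ring_scope.

(* A tensor in \bigotimes_(i : I) K^(d i) is the array of its coordinates in
   the standard basis.  K^o is K seen as a vector space over itself. *)
Notation multi_index d := {dffun forall i, 'I_(d i)}.
Notation tensor K d := {ffun multi_index d -> K^o}.

(** * Projective space and its Zariski topology *)

Section Projective.
Variables (K : fieldType) (V : vectType K).

Definition proj := {L : {vspace V} | \dim L == 1%N}.

(* psi is a (nonzero) representative of the class x, i.e. x = [psi]. *)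
Definition represents (psi : V) (x : proj) : Prop :=
  psi != 0 /\ psi \in val x.

Definition projectivization (X : set V) : set proj :=
  [set x | exists psi : V, represents psi x /\ X psi]%classic.

End Projective.

Section Zariski.
Variables (K : fieldType) (J : finType).
Local Notation V := {ffun J -> K^o}.

(* The coordinates of K^J are numbered by the enumeration of J. *)
Definition poly_value (p : {mpoly K[#|J|]}) (psi : V) : K :=
  p.@[fun k : 'I_#|J| => psi (enum_val k)].

Definition zero_locus (S : set {mpoly K[#|J|]}) : set (proj V) :=
  [set x | forall p, S p ->
           forall psi, represents psi x -> poly_value p psi = 0]%classic.

Definition zariski_closed (Z : set (proj V)) : Prop :=
  exists S : set {mpoly K[#|J|]},
    (forall p, S p -> exists k : nat, p \is k.-homog) /\ Z = zero_locus S.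

Definition zariski_closure (X : set (proj V)) : set (proj V) :=
  (\bigcap_(Z in [set Z | zariski_closed Z /\ X `<=` Z]) Z)%classic.

End Zariski.

(** * Tensor trains *)

Section TensorTrain.
Variables (K : fieldType) (N : nat) (d : 'I_N -> nat) (r : 'I_N.+1 -> nat).

(* Sites are numbered from 0: site i : 'I_N has the bond i on its left and the
   bond i + 1 on its right. *)
Definition bondl (i : 'I_N) : 'I_N.+1 := widen_ord (leqnSn N) i.
Definition bondr (i : 'I_N) : 'I_N.+1 := lift ord0 i.

Definition tt_cores :=
  forall i : 'I_N, 'I_(d i) -> 'I_(r (bondr i)) -> 'I_(r (bondl i)) -> K.

(* The sum also runs over the two boundary bonds, which have only one value
   when r 0 = r N = 1. *)
Definition tt_tensor (A : tt_cores) : tensor K d :=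
  [ffun j : multi_index d =>
     \sum_(alpha : multi_index r)
       \prod_(i < N) A i (j i) (alpha (bondr i)) (alpha (bondl i))].

Definition TT : set (proj (tensor K d)) :=
  zariski_closure
    (projectivization [set psi | exists A, psi = tt_tensor A]%classic).

End TensorTrain.

Arguments TT K {N} d r.

(** * Rooted trees *)

(* A finite rooted tree is given by its parent function, with the convention
   that the root is its own parent. *)
Record rooted_tree := RootedTree {
  vertex :> finType;
  root : vertex;
  parent : vertex -> vertex;
  parent_root : parent root = root;
  root_reached : forall v, exists n, iter n parent v = root }.

Definition children (T : rooted_tree) (v : T) : {set T} :=
  [set u | (u != root T) && (parent u == v)].

Definition is_leaf (T : rooted_tree) (v : T) : bool := children v == finset.set0.

Definition tree_edge (T : rooted_tree) (u v : T) : bool :=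
  (u \in children v) || (v \in children u).

(* u is a descendant of v, possibly v itself. *)
Definition descends (T : rooted_tree) (v u : T) : bool :=
  fconnect (@parent T) u v.

(* A rooted tree whose set of leaves is {lambda_i | i : I}. *)
Record leaf_tree (I : finType) := LeafTree {
  ltree :> rooted_tree;
  leaf : I -> ltree;
  leaf_inj : injective leaf;
  leafP : forall v : ltree, is_leaf v = (v \in codom leaf) }.

Lemma child_descends (T : rooted_tree) (v u w : T) :
  u \in children v -> descends u w -> descends v w.
Proof.
rewrite inE => /andP[_ /eqP <-] uw.
exact: connect_trans uw (fconnect1 _ _).
Qed.

Lemma descends_root (T : rooted_tree) (v : T) : descends (root T) v.
Proof. by have [n <-] := root_reached v; exact: fconnect_iter. Qed.

(** * Tree tensor networks *)

Section TreeTensorNetwork.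
Variables (K : fieldType) (I : finType) (T : leaf_tree I).
Variables (d : I -> nat) (r : T -> nat).

Definition leaf_below (v : T) := {i : I | descends v (leaf T i)}.

(* The tensor product of the spaces K^(d i) over the leaves that descend from
   v.  It is K^(d i) itself if v is the leaf i, and all subspaces U_v live in
   it. *)
Notation block v := (tensor K (fun l : leaf_below v => d (val l))).

Definition child_leaf (v : T) (u : {u : T | u \in children v})
  (l : leaf_below (val u)) : leaf_below v :=
  exist _ (val l) (child_descends (valP u) (valP l)).

Definition restrict_child (v : T) (u : {u : T | u \in children v})
  (j : multi_index (fun l : leaf_below v => d (val l))) :
  multi_index (fun l : leaf_below (val u) => d (val l)) :=
  [ffun l => j (child_leaf l)].

(* The pure tensor of the w u, u a child of v.  The leaves below an internal
   vertex v are split by its children, whence the tensor product of the blocks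
   of the children is the block of v. *)
Definition pure_tensor (v : T)
  (w : forall u : {u : T | u \in children v}, block (val u)) : block v :=
  [ffun j => \prod_u w u (restrict_child u j)].

(* phi belongs to the tensor product of the U u over the children u of v: it is
   a finite sum of pure tensors. *)
Definition in_tensor_product (U : forall u : T, {vspace block u}) (v : T)
  (phi : block v) : Prop :=
  exists n : nat,
  exists w : 'I_n -> forall u : {u : T | u \in children v}, block (val u),
    (forall k u, w k u \in U (val u)) /\ phi = \sum_(k < n) pure_tensor (w k).

(* All leaves descend from the root, so that the block of the root is the whole
   space. *)
Definition root_leaf (i : I) : leaf_below (root T) :=
  exist _ i (descends_root (leaf T i)).

Definition to_root_block (psi : tensor K d) : block (root T) :=
  [ffun j : multi_index (fun l : leaf_below (root T) => d (val l)) =>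
     psi [ffun i => j (root_leaf i)]].

Definition rank_at (v : T) : nat := if v == root T then 1%N else r v.

Definition TTN : set (proj (tensor K d)) :=
  projectivization
    [set psi | exists U : forall v : T, {vspace block v},
      [/\ forall v, (\dim (U v) <= rank_at v)%N,
          forall v, ~~ is_leaf v ->
            forall phi, phi \in U v -> in_tensor_product U phi
        & to_root_block psi \in U (root T)]]%classic.

End TreeTensorNetwork.

Arguments TTN K {I} T d r.

(** * The tree of a tensor train *)

Section TrainTree.
Variables (N : nat) (hN : (0 < N)%N).

(* With indices starting from 0, inl i is the leaf lambda_i and inr i is the
   internal vertex v_i; the root is v_0. *)
Definition train_vertex : finType := ('I_N + 'I_N)%type.

Definition train_root : train_vertex := inr (Ordinal hN).

Definition train_parent (x : train_vertex) : train_vertex :=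
  match x with
  | inl i => inr i
  | inr i => inr (Ordinal (leq_ltn_trans (leq_pred i) (ltn_ord i)))
  end.

Lemma train_parent_root : train_parent train_root = train_root.
Proof. by congr inr; apply: val_inj. Qed.

Lemma train_root_reached x : exists n, iter n train_parent x = train_root.
Proof.
have vP m : forall i : 'I_N, i = m :> nat ->
    exists n, iter n train_parent (inr i) = train_root.
  elim: m => [|m IHm] i im; first by exists 0%N; congr inr; apply: val_inj.
  have [|n nP] := IHm (Ordinal (leq_ltn_trans (leq_pred i) (ltn_ord i))).
    by rewrite /= im.
  by exists n.+1; rewrite iterSr.
case: x => i; last exact: vP (erefl _).
by have [n nP] := vP i i (erefl _); exists n.+1; rewrite iterSr.
Qed.

Definition train_rooted_tree : rooted_tree :=
  RootedTree train_parent_root train_root_reached.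

Lemma train_leafP (x : train_rooted_tree) :
  is_leaf x = (x \in codom (inl : 'I_N -> train_vertex)).
Proof.
case: x => i.
  rewrite codom_f; apply/eqP/setP => -[k|k]; rewrite !inE //=.
  by apply/negP => /andP[_ /eqP].
have -> : (inr i \in codom (inl : 'I_N -> train_vertex)) = false.
  by apply/negP => /codomP[k].
apply/negP => /eqP/setP/(_ (inl i)).
by rewrite !inE /= eqxx.
Qed.

Lemma train_leaf_inj : injective (inl : 'I_N -> train_vertex).
Proof. by move=> i k []. Qed.

Definition train_tree : leaf_tree 'I_N :=
  @LeafTree _ train_rooted_tree _ train_leaf_inj train_leafP.

Lemma train_tree_edge (x y : train_tree) :
  tree_edge x y =
  match x, y with
  | inl _, inl _ => false
  | inl i, inr k | inr k, inl i => i == k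
  | inr i, inr k => (k == i.+1 :> nat) || (i == k.+1 :> nat)
  end.
Proof.
have inr_eq (i k : 'I_N) : (inr i == inr k :> train_vertex) = (i == k) by [].
have inrE (i k : 'I_N) :
    ((inr i : train_vertex) != train_root) &&
    (train_parent (inr i) == inr k) = (i == k.+1 :> nat).
  rewrite !inr_eq -!val_eqE /=.
  by case: (i : nat) => //= m; rewrite eqSS.
have inlE (i k : 'I_N) :
    ((inr i : train_vertex) != train_root) &&
    (train_parent (inr i) == inl k) = false by rewrite andbF.
case: x => i; case: y => k; rewrite /tree_edge !inE //=.
- by rewrite inlE orbF inr_eq.
- by rewrite inlE inr_eq eq_sym.
- by rewrite !inrE orbC.
Qed.

Definition train_rank (d : 'I_N -> nat) (r : 'I_N.+1 -> nat) (x : train_tree) :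
  nat :=
  match x with
  | inl i => d i
  | inr i => r (bondl i)
  end.

End TrainTree.

(* Main.v *)
Require Import Defs.
From mathcomp Require Import all_boot all_algebra complex reals.
From mathcomp Require Import mpoly classical_sets.

(* Both varieties consist of the [psi] whose flattening at every bond m (sites
   < m against sites >= m) has rank at most r m, a condition given by the
   vanishing of minors, hence closed.
   - The contractions of a tensor train on the right of the bonds span spaces
     U_(v_m) that exhibit the train as a tree tensor network.
   - In a tree tensor network, fixing the first m indices of psi gives elements
     of U_(v_m), so the flattening at m has rank at most dim U_(v_m).
   - If the ranks are bounded, expanding a spanning family of the row space of
     the flattening at m over one for m + 1 yields the cores of a train. *)

Set Implicit Arguments.
Unset Strict Implicit.
Unset Printing Implicit Defensive.

Import GRing.Theory.
Local Open Scope ring_scope.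

(** * Determinantal conditions *)

Section Minors.
Variable K : fieldType.

Lemma row_free_rowsub m n p (f : 'I_p -> 'I_m) (A : 'M[K]_(m, n)) :
  injective f -> row_free A -> row_free (rowsub f A).
Proof.
move=> f_inj /row_freeP[B AB1]; apply/row_freeP; exists (colsub f B).
rewrite mul_rowsub_mx mulmx_colsub AB1; apply/matrixP => i j.
by rewrite !mxE (inj_eq f_inj).
Qed.

(** A submatrix is a product with [M] in the middle, so it cannot be invertible if its size exceeds
    [\rank M]. Conversely, k + 1 of the independent rows picked by [maxrankfun] have full rank, and
    k + 1 suitable columns of them give an invertible minor. *)
Lemma rank_leP m n (M : 'M[K]_(m, n)) k :
  (\rank M <= k)%N <->
  (forall (f : 'I_k.+1 -> 'I_m) (g : 'I_k.+1 -> 'I_n), \det (mxsub f g M) = 0).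
Proof.
split=> [rkM f g | minor0].
  apply/eqP; apply: contraLR rkM; rewrite -unitfE -unitmxE -ltnNge => unitMfg.
  rewrite -(mxrank_unit unitMfg).
  have -> : mxsub f g M = rowsub f 1%:M *m (M *m colsub g 1%:M).
    by rewrite mulmx_colsub mulmx1 mul_rowsub_mx mul1mx -mxsub_comp.
  exact: leq_trans (mxrankM_maxr _ _) (mxrankM_maxl _ _).
case: leqP => // ltkM; pose h := widen_ord ltkM.
have h_inj : injective h by move=> i j /(congr1 val) /= ij; apply: val_inj.
have free_h := row_free_rowsub h_inj (maxrowsub_free M).
have full_h : row_full (rowsub h (rowsub (maxrankfun M) M))^T.
  by rewrite -col_leq_rank mxrank_tr row_leq_rank.
have := fullrowsub_unit full_h.
set g := fullrankfun _; rewrite -trmx_mxsub unitmx_tr -!mxsub_comp unitmxE.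
by rewrite (minor0 (maxrankfun M \o (h \o id)) (id \o g)) unitr0.
Qed.

(** A basis of the row space is padded with zero rows to exactly [k] rows, the size of a bond. *)
Lemma rank_le_spanning_rows m n k (M : 'M[K]_(m, n)) : (\rank M <= k)%N ->
  exists B : 'M[K]_(k, n), (B :=: M)%MS.
Proof.
move=> rkM; exists ((pid_mx (\rank M) : 'M_(k, \rank M)) *m row_base M).
apply: eqmx_trans (eq_row_base M); apply: eqmxMfull.
by rewrite -col_leq_rank rank_pid_mx.
Qed.

End Minors.

Section GenericDeterminant.
Variables (K : fieldType) (J : finType) (s : nat) (e : 'I_s -> 'I_s -> J).

Definition generic_det : {mpoly K[#|J|]} :=
  \det (\matrix_(p, q) 'X_(enum_rank (e p q)) : 'M[{mpoly K[#|J|]}]_s).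

Lemma generic_det_homog : generic_det \is s.-homog.
Proof.
apply: rpred_sum => sigma _; rewrite rpredMsign.
(* The degree is written as a sum of ones so that it grows with the product, factor by factor. *)
set P := \prod_p _; suff: P \is (\sum_(p < s) 1)%N.-homog.
  by rewrite sum1_card card_ord.
rewrite {}/P.
elim/big_rec2: _ => [|p n P _ P_homog]; first exact: dhomog1.
by apply: dhomogM => //; rewrite mxE dhomogX; apply/eqP/mdeg1.
Qed.

Lemma generic_detE (psi : {ffun J -> K^o}) :
  poly_value generic_det psi = \det (\matrix_(p, q) psi (e p q) : 'M[K]_s).
Proof.
rewrite /poly_value -det_map_mx; congr (\det _); apply/matrixP => p q.
by rewrite !mxE; apply: etrans (mevalXU _ _) _; rewrite enum_rankK.
Qed.

End GenericDeterminant.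

(** * Multi-indices *)

Section MultiIndex.
Variables (I : finType) (d : I -> nat).

Definition update (k : multi_index d) (i : I) (x : 'I_(d i)) : multi_index d :=
  [ffun l => dfwith k x l].

Lemma update_in k i x : @update k i x i = x.
Proof. by rewrite ffunE dfwith_in. Qed.

Lemma update_out k i x l : i != l -> @update k i x l = k l.
Proof. by move=> il; rewrite ffunE dfwith_out. Qed.

Lemma update_id (k : multi_index d) i : update k (k i) = k.
Proof. by apply/ffunP => l; rewrite ffunE; case: dfwithP. Qed.

Lemma update_update k i (x y : 'I_(d i)) : update (update k x) y = update k y.
Proof.
apply/ffunP => l; rewrite !ffunE; have [-> | il] := eqVneq l i.
  by rewrite !dfwith_in.
by rewrite !dfwith_out 1?eq_sym // ffunE dfwith_out // eq_sym.
Qed.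

End MultiIndex.

(** * Partial contractions of a tensor train *)

Section TrainContraction.
Variables (K : fieldType) (N : nat) (d : 'I_N -> nat) (r : 'I_N.+1 -> nat).
Variables (A : tt_cores K d r) (z : multi_index r).

(* Contraction of the cores on the right of the bond m, whose value is a; the
   bonds on the left of m do not occur in it, and are frozen to z. *)
Definition right_contraction (m : 'I_N.+1) (a : 'I_(r m)) (k : multi_index d) :
  K :=
  \sum_(alpha : multi_index r |
        (alpha m == a) && [forall l : 'I_N.+1, (l < m)%N ==> (alpha l == z l)])
     \prod_(i < N | (m <= i)%N)
        A (k i) (alpha (bondr i)) (alpha (bondl i)).

Lemma right_contraction_eq (m : 'I_N.+1) (a : 'I_(r m)) (k k' : multi_index d) :
  (forall i : 'I_N, (m <= i)%N -> k i = k' i) ->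
  right_contraction a k = right_contraction a k'.
Proof.
move=> kk'; apply: eq_bigr => alpha _; apply: eq_bigr => i mi.
by rewrite kk'.
Qed.

(** Freezing leaves the single multi-index [update z a], and no core lies to the right of the last
    bond. *)
Lemma right_contraction_last a k : @right_contraction ord_max a k = 1.
Proof.
rewrite /right_contraction (big_pred1 (update z a)) => [|alpha].
  by rewrite big_pred0 // => i; rewrite leqNgt ltn_ord.
apply/andP/eqP => [[/eqP <- /forallP alphaz] | ->].
  apply/ffunP => l; rewrite ffunE; case: dfwithP => // i ltiN; apply/eqP.
  apply: implyP (alphaz i) _; move: ltiN; rewrite eq_sym -val_eqE /=.
  by rewrite ltn_neqAle -ltnS ltn_ord andbT.
rewrite update_in eqxx; split=> //; apply/forallP => l; apply/implyP => ltlN.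
by rewrite update_out // -val_eqE gtn_eqF.
Qed.

(** The core at site i is split off, and the remaining sum is grouped by the value [b] of the next
    bond. *)
Lemma right_contraction_rec (i : 'I_N) (a : 'I_(r (bondl i))) k :
  right_contraction a k =
  \sum_(b < r (bondr i)) A (k i) b a * right_contraction b k.
Proof.
pose G (alpha : multi_index r) := A (k i) (alpha (bondr i)) a *
  \prod_(l < N | (i < l)%N) A (k l) (alpha (bondr l)) (alpha (bondl l)).
pose P (alpha : multi_index r) :=
  [forall l : 'I_N.+1, (l <= i)%N ==> (alpha l == z l)].
transitivity (\sum_(alpha | P alpha) G alpha).
  rewrite /right_contraction [LHS](reindex_onto (fun alpha => update alpha a)
    (fun alpha => update alpha (z (bondl i)))) /=; last first.
    by move=> alpha /andP[/eqP <- _]; rewrite update_update update_id.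
  apply: eq_big => alpha.
    rewrite update_in eqxx /= update_update.
    apply/andP/forallP => [[/forallP alphaz /eqP zi] l | alphaz].
      apply/implyP; rewrite leq_eqVlt => /orP[/eqP li | ltli].
        by rewrite -zi (_ : l = bondl i) ?update_in //; apply: val_inj.
      have := implyP (alphaz l) ltli; rewrite update_out //.
      by rewrite -val_eqE gtn_eqF.
    split; last first.
      rewrite -{2}[alpha](update_id alpha (bondl i)).
      by rewrite (eqP (implyP (alphaz (bondl i)) _)).
    apply/forallP => l; apply/implyP => ltli.
    by rewrite update_out ?(implyP (alphaz l)) ?(ltnW ltli) // -val_eqE gtn_eqF.
  move=> _; rewrite (bigD1 i) //= update_in update_out; last first.
    by rewrite -val_eqE /= /bump /= ltn_eqF.
  congr (_ * _); apply: eq_big => [l | l /andP[leil neli]].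
    by rewrite ltn_neqAle eq_sym andbC.
  have ltil : (i < l)%N by rewrite ltn_neqAle eq_sym neli.
  by rewrite !update_out // -val_eqE /= ltn_eqF // /bump ltnS ltnW.
rewrite (partition_big (fun alpha : multi_index r => alpha (bondr i)) xpredT) //.
apply: eq_bigr => b _; rewrite big_distrr /=.
apply: eq_big => [alpha | alpha /andP[_ /eqP <-] //].
by rewrite andbC.
Qed.

Lemma right_contraction_first a k : r ord0 = 1%N ->
  @right_contraction ord0 a k = tt_tensor A k.
Proof.
move=> r01; rewrite ffunE; apply: eq_bigl => alpha.
move: (alpha ord0) a; rewrite r01 => x a; rewrite [x]ord1 [a]ord1 eqxx.
by apply/forallP => l; rewrite ltn0.
Qed.

(** The recursion determines [b] from the last bond leftwards, hence the induction on [N - m]. This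
    shows later that cores built from [psi] contract to [psi]. *)
Lemma right_contraction_unique (b : forall m : 'I_N.+1, 'I_(r m) ->
    multi_index d -> K) :
  (forall a k, b ord_max a k = 1) ->
  (forall (i : 'I_N) (a : 'I_(r (bondl i))) k,
     b _ a k = \sum_(c < r (bondr i)) A (k i) c a * b _ c k) ->
  forall m a k, b m a k = right_contraction a k.
Proof.
move=> b_last b_rec.
suff IH s : forall m : 'I_N.+1, (N - m)%N = s ->
    forall a k, b m a k = right_contraction a k.
  by move=> m; apply: IH erefl.
elim: s => [|s IHs] m.
  move/eqP; rewrite subn_eq0 => leNm a k; move: a.
  have -> : m = ord_max.
    by apply/val_inj/eqP; rewrite eqn_leq leNm -ltnS ltn_ord.
  by move=> a; rewrite b_last right_contraction_last.
move=> Nms; have ltmN : (m < N)%N by rewrite -subn_gt0 Nms.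
have -> : m = bondl (Ordinal ltmN) by apply: val_inj.
move=> a k; rewrite b_rec right_contraction_rec; apply: eq_bigr => c _.
by rewrite IHs // lift0 /= subnS Nms.
Qed.

End TrainContraction.

(** * Subspaces attached to the tree of a tensor train *)

Section Blocks.
Variables (I : finType) (T : leaf_tree I) (d : I -> nat) (k0 : multi_index d).
Local Notation block_index v := (multi_index (fun l : leaf_below v => d (val l))).

Definition restrict_below (v : T) (k : multi_index d) : block_index v :=
  [ffun l => k (val l)].

(* The value of the extension away from the leaves below v is irrelevant; it is
   taken from k0. *)
Definition extend_below (v : T) (j : block_index v) : multi_index d :=
  [ffun i => match @idP (descends v (leaf T i)) with
             | ReflectT vi => j (exist _ i vi)
             | ReflectF _ => k0 i
             end].

Lemma extend_belowE v (j : block_index v) (l : leaf_below v) :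
  extend_below j (val l) = j l.
Proof.
rewrite ffunE; case: l => i vi /=; case: {-}_ / idP => // vi'.
by rewrite (bool_irrelevance vi' vi).
Qed.

Lemma extend_restrict_child v (u : {u : T | u \in children v})
    (j : block_index v) i :
  descends (val u) (leaf T i) ->
  extend_below (restrict_child u j) i = extend_below j i.
Proof.
move=> ui; rewrite (extend_belowE _ (exist _ i ui)) ffunE.
exact: esym (extend_belowE _ (child_leaf (exist _ i ui))).
Qed.

Lemma extend_restrict_below (v : T) (k : multi_index d) i :
  descends v (leaf T i) -> extend_below (restrict_below v k) i = k i.
Proof. by move=> vi; rewrite (extend_belowE _ (exist _ i vi)) ffunE. Qed.

End Blocks.

Section TrainTree.
Variables (N : nat) (hN : (0 < N)%N).
Local Notation T := (train_tree hN).
Local Notation lambda i := (inl i : T).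
Local Notation node i := (inr i : T).

(** Truncated subtraction agrees with the root being its own parent. *)
Lemma iter_parent_node n (i : 'I_N) : exists2 l : 'I_N,
  iter n (@parent T) (node i) = node l & l = (i - n)%N :> nat.
Proof.
elim: n => [|n [l il ln]]; first by exists i; rewrite ?subn0.
exists (Ordinal (leq_ltn_trans (leq_pred l) (ltn_ord l))).
  by rewrite iterS il.
by rewrite /= ln subnS.
Qed.

(** Every proper ancestor of a leaf is an internal node. *)
Lemma descends_lambda (i l : 'I_N) : descends (lambda i) (lambda l) = (l == i).
Proof.
apply/idP/eqP => [/iter_findex | ->]; last exact: connect0.
case: findex => [[]|n] //; rewrite iterSr.
by have [m im _] := iter_parent_node n l; rewrite [iter _ _ _]im.
Qed.

Lemma descends_node (i l : 'I_N) : descends (node i) (lambda l) = (i <= l)%N.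
Proof.
apply/idP/idP => [/iter_findex | leil].
  case: findex => [//|n]; have [m im ml] := iter_parent_node n l.
  by rewrite iterSr [iter _ _ _]im => -[mi]; rewrite -mi ml leq_subr.
have [m im ml] := iter_parent_node (l - i) l.
suff -> : node i = iter (l - i).+1 (@parent T) (lambda l) by apply: fconnect_iter.
by rewrite iterSr [iter _ _ _]im; congr inr; apply: val_inj; rewrite /= ml subKn.
Qed.

Lemma node_not_leaf (i : 'I_N) : ~~ is_leaf (node i).
Proof. by rewrite leafP; apply/negP => /codomP[]. Qed.

Lemma lambda_child (i : 'I_N) : lambda i \in children (node i).
Proof. by rewrite inE eqxx. Qed.

Lemma node_child (i l : 'I_N) : l = i.+1 :> nat -> node l \in children (node i).
Proof.
move=> li; rewrite inE; apply/andP; split; apply/eqP.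
  by case=> l0; rewrite l0 in li.
by congr inr; apply: val_inj; rewrite /= li.
Qed.

Lemma child_nodeP (i : 'I_N) (u : T) : u \in children (node i) ->
  u = lambda i \/ exists2 l : 'I_N, l = i.+1 :> nat & u = node l.
Proof.
rewrite inE; case: u => l /andP[lroot /eqP[li]]; first by left; rewrite li.
right; exists l => //; rewrite -li /= prednK // lt0n.
by apply: contraNneq lroot => l0; apply/eqP; congr inr; apply: val_inj.
Qed.

Variable R : comNzRingType.

Lemma prod_children_last (i : 'I_N) (iN : i.+1 = N)
    (G : {u : T | u \in children (node i)} -> R) :
  \prod_u G u = G (exist _ (lambda i) (lambda_child i)).
Proof.
rewrite (bigD1 (exist _ (lambda i) (lambda_child i))) //= big1 ?mulr1 //.
move=> u; rewrite -val_eqE /=; case: (child_nodeP (valP u)) => [->|].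
  by rewrite eqxx.
by case=> l; rewrite iN => lN; have := ltn_ord l; rewrite lN ltnn.
Qed.

Lemma prod_children_inner (i l : 'I_N) (li : l = i.+1 :> nat)
    (G : {u : T | u \in children (node i)} -> R) :
  \prod_u G u = G (exist _ (lambda i) (lambda_child i)) *
                G (exist _ (node l) (node_child li)).
Proof.
rewrite (bigD1 (exist _ (lambda i) (lambda_child i))) //=; congr (_ * _).
rewrite (bigD1 (exist _ (node l) (node_child li))) //= big1 ?mulr1 //.
move=> u; rewrite -!val_eqE /=; case: (child_nodeP (valP u)) => [->|].
  by rewrite eqxx.
case=> l' l'i ->; rewrite (_ : l' = l) ?eqxx ?andbF //.
by apply: val_inj; rewrite /= li.
Qed.

End TrainTree.

(** * From tensor trains to tree tensor networks *)

Section TrainToTree.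
Variables (K : fieldType) (N : nat) (hN : (0 < N)%N).
Variables (d : 'I_N -> nat) (r : 'I_N.+1 -> nat).
Hypothesis r0 : r ord0 = 1%N.
Variables (k0 : multi_index d) (z : multi_index r).
Local Notation T := (train_tree hN).
Local Notation lambda i := (inl i : T).
Local Notation node i := (inr i : T).
Local Notation block v := (tensor K (fun l : leaf_below v => d (val l))).

Lemma rank_at_lambda i : rank_at (train_rank d r) (lambda i) = d i.
Proof. by []. Qed.

Lemma rank_at_node i : rank_at (train_rank d r) (node i) = r (bondl i).
Proof.
rewrite /rank_at; case: eqP => // -[->].
by rewrite -[LHS]r0; congr r; apply: val_inj.
Qed.

(** A multi-index over the only leaf below [lambda i] is determined by its one entry. *)
Lemma dim_lambda_block i : (\dim {:block (lambda i)} <= d i)%N.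
Proof.
rewrite dimvf /dim /= muln1 -[d i]card_ord.
have ii : descends (lambda i) (leaf T i) by apply: connect0.
apply: (leq_card (fun j : multi_index (fun l : leaf_below (lambda i) => d (val l))
                  => j (exist _ i ii))) => j j' jj'.
apply/ffunP => -[l li]; have /eqP ei : l == i by rewrite -(descends_lambda hN).
by move: li; rewrite ei => li; rewrite (bool_irrelevance li ii).
Qed.

Variable A : tt_cores K d r.

Definition contraction_block (v : T) (m : 'I_N.+1) (a : 'I_(r m)) : block v :=
  [ffun j => right_contraction A z a (extend_below k0 j)].

Definition contraction_space (v : T) : {vspace block v} :=
  match v with
  | inl i => fullv
  | inr i =>
      <<[tuple contraction_block (node i) a | a < r (bondl i)]>>%VS
  end.

Lemma contraction_block_in (i : 'I_N) (a : 'I_(r (bondl i))) :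
  contraction_block (node i) a \in contraction_space (node i).
Proof.
rewrite -[contraction_block _ _](tnth_mktuple (@contraction_block (node i) _)).
exact: memv_span (mem_tnth _ _).
Qed.

(** By [right_contraction_rec], [phi] expands over the bond to the right of site i: each term pairs
    a vector on the leaf with a contraction in the space of the next node. *)
Lemma contraction_space_tensor (i : 'I_N) (phi : block (node i)) :
  phi \in contraction_space (node i) ->
  in_tensor_product contraction_space phi.
Proof.
move=> /coord_span; set X := [tuple _ | _ < _] => phiE.
(* The coordinates of [phi] in the spanning family absorb the left bond of the core. *)
pose c b x := \sum_a coord X a phi * @A i x b a.
exists (r (bondr i)), (fun b u => [ffun j => match val u with
  | inl _ => c b (extend_below k0 j i)
  | inr _ => right_contraction A z b (extend_below k0 j)
  end]).
split=> [b [u uP]|].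
  case: (child_nodeP uP) => [ui | [l li ul]]; move: uP.
    by rewrite ui /= => uP; rewrite memvf.
  rewrite ul /= => uP.
  have eb : bondr i = bondl l by apply: ord_inj; rewrite lift0 /= li.
  move: b; rewrite eb => b; exact: contraction_block_in.
apply/ffunP => j; rewrite {1}phiE !sum_ffunE.
transitivity (\sum_(b < r (bondr i))
    c b (extend_below k0 j i) * right_contraction A z b (extend_below k0 j)).
  under [RHS]eq_bigr do rewrite mulr_suml.
  rewrite exchange_big; apply: eq_bigr => a _.
  rewrite -tnth_nth tnth_mktuple [LHS]ffunE [X in _ *: X]ffunE.
  rewrite right_contraction_rec scaler_sumr; apply: eq_bigr => b _.
  exact: mulrA.
have lamE : extend_below k0
    (restrict_child (exist _ (lambda i) (lambda_child hN i)) j) i =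
    extend_below k0 j i.
  by apply: extend_restrict_child; rewrite /= descends_lambda.
apply: eq_bigr => b _; rewrite [RHS]ffunE.
(* The last node has only a leaf as child, and the contraction past the last bond is 1, so the leaf
   factor alone gives the term. *)
have [iN | ltiN] : i.+1 = N \/ (i.+1 < N)%N.
  by have := ltn_ord i; rewrite leq_eqVlt => /orP[/eqP|]; [left | right].
  have eb : bondr i = ord_max by apply: ord_inj; rewrite lift0 /= iN.
  have -> : right_contraction A z b (extend_below k0 j) = 1.
    by move: b; rewrite eb => b; rewrite right_contraction_last.
  rewrite mulr1 (prod_children_last iN) [RHS]ffunE.
  exact: congr1 (esym lamE).
rewrite (@prod_children_inner _ _ _ i (Ordinal ltiN) erefl); congr (_ * _).
  by rewrite [RHS]ffunE; exact: congr1 (esym lamE).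
rewrite [RHS]ffunE; apply: right_contraction_eq => l; rewrite lift0 => ltil.
by apply/esym/extend_restrict_child; rewrite /= descends_node.
Qed.

Lemma tt_tensor_tree : exists U : forall v : T, {vspace block v},
  [/\ forall v, (\dim (U v) <= rank_at (train_rank d r) v)%N,
      forall v, ~~ is_leaf v -> forall phi, phi \in U v -> in_tensor_product U phi
    & to_root_block T (tt_tensor A) \in U (Defs.root T)].
Proof.
exists contraction_space; split.
- case=> i; first by rewrite rank_at_lambda; apply: dim_lambda_block.
  by rewrite rank_at_node; apply: leq_trans (dim_span _) _; rewrite size_tuple.
- case=> i; last by move=> _; apply: contraction_space_tensor.
  by rewrite leafP codom_f.
(* The bond to the left of the root site has a single value [a], whose contraction is the whole
   train. *)
have eb : bondl (Ordinal hN) = ord0 by apply: val_inj.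
have [a _] : exists a : 'I_(r (bondl (Ordinal hN))), true.
  by rewrite eb r0; exists ord0.
rewrite (_ : to_root_block _ _ = contraction_block (Defs.root T) a).
  exact: contraction_block_in.
apply/ffunP => j.
rewrite [LHS]ffunE [RHS]ffunE; move: a; rewrite eb => a.
rewrite right_contraction_first //; congr (tt_tensor A _).
apply/ffunP => i; rewrite ffunE.
exact: esym (extend_belowE _ _ (root_leaf T i)).
Qed.

End TrainToTree.

(** * Flattenings *)

Section Flattenings.
Variables (K : fieldType) (N : nat) (d : 'I_N -> nat).
Implicit Types (psi : tensor K d) (j k : multi_index d).

Definition splice (m : nat) j k : multi_index d :=
  [ffun i : 'I_N => if (i < m)%N then j i else k i].

Lemma splice0 j k : splice 0 j k = k.
Proof. by apply/ffunP => i; rewrite ffunE. Qed.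

Lemma splice_last j k : splice N j k = j.
Proof. by apply/ffunP => i; rewrite ffunE ltn_ord. Qed.

Lemma splice_eqr m j k k' : (forall i : 'I_N, (m <= i)%N -> k i = k' i) ->
  splice m j k = splice m j k'.
Proof.
by move=> kk'; apply/ffunP => i; rewrite !ffunE; case: ltnP => // /kk'.
Qed.

(** The entry [x] at site i passes between the row index and the column index. *)
Lemma splice_succ (i : 'I_N) j k (x : 'I_(d i)) :
  splice i.+1 (update j x) k = splice i j (update k x).
Proof.
apply/ffunP => l; rewrite !ffunE ltnS leq_eqVlt.
have [-> | neil] := eqVneq l i; first by rewrite eqxx ltnn !dfwith_in.
have -> : (l == i :> nat) = false by apply/negbTE.
by rewrite /= !dfwith_out // eq_sym.
Qed.

(* Rows and columns are both indexed by all multi-indices: the entries of the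
   row index at the sites >= m, and those of the column index at the sites < m,
   are ignored.  Repeated rows and columns do not affect the rank. *)
Definition flattening psi (m : nat) : 'M[K]_#|{: multi_index d}| :=
  \matrix_(p, q) psi (splice m (enum_val p) (enum_val q)).

Lemma flatteningZ (c : K) psi m : flattening (c *: psi) m = c *: flattening psi m.
Proof. by apply/matrixP => p q; rewrite !mxE ffunE. Qed.

Lemma rank_flattening_last psi : (\rank (flattening psi N) <= 1)%N.
Proof.
have -> : flattening psi N =
    (\col_p psi (enum_val p)) *m (const_mx 1 : 'rV_#|{: multi_index d}|).
  by apply/matrixP => p q; rewrite !mxE big_ord1 !mxE mulr1 splice_last.
exact: mulmx_max_rank.
Qed.

Variable r : 'I_N.+1 -> nat.

Definition bounded_flattenings : set (tensor K d) :=
  [set psi | forall m : 'I_N.+1, (\rank (flattening psi m) <= r m)%N]%classic.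

(** * Rank bounds from a tree tensor network *)

Section TreeToFlattenings.
Variables (hN : (0 < N)%N) (k0 : multi_index d).
Local Notation T := (train_tree hN).
Local Notation lambda i := (inl i : T).
Local Notation node i := (inr i : T).
Local Notation block v := (tensor K (fun l : leaf_below v => d (val l))).
Variables (U : forall v : T, {vspace block v}) (psi : tensor K d).
Hypothesis U_tensor : forall v, ~~ is_leaf v ->
  forall phi, phi \in U v -> in_tensor_product U phi.
Hypothesis psi_root : to_root_block T psi \in U (Defs.root T).

Definition slice (i : 'I_N) j : block (node i) :=
  [ffun jj => psi (splice i j (extend_below k0 jj))].

Lemma sliceE (i : 'I_N) j k :
  slice i j (restrict_below (node i) k) = psi (splice i j k).
Proof.
rewrite ffunE; congr (psi _); apply: splice_eqr => l il.
by rewrite extend_restrict_below ?descends_node.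
Qed.

(** Fixing one more index, that of site i, turns the leaf factor of each pure tensor of [slice i j]
    into a scalar; this leaves a combination of vectors of [U (node l)]. *)
Lemma slice_succ (i l : 'I_N) : l = i.+1 :> nat ->
  (forall j, slice i j \in U (node i)) -> forall j, slice l j \in U (node l).
Proof.
move=> li slice_in j.
have [n [w [w_in sliceP]]] := U_tensor (node_not_leaf hN i) (slice_in j).
pose jl : multi_index (fun s : leaf_below (lambda i) => d (val s)) :=
  restrict_below (lambda i) j.
have -> : slice l j = \sum_(s < n) w s (exist _ (lambda i) (lambda_child hN i)) jl
    *: w s (exist _ (node l) (node_child hN li)).
  apply/ffunP => jj; rewrite ffunE sum_ffunE.
  (* [slice l j] is [slice i j] read at the indices whose entry at site i is [j i]. *)
  rewrite li -{1}(update_id j i) splice_succ -sliceE sliceP sum_ffunE.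
  apply: eq_bigr => s _; rewrite !ffunE (prod_children_inner li).
  rewrite (_ : restrict_child (exist _ (lambda i) _) _ = jl); last first.
    apply/ffunP => -[t it]; rewrite !ffunE /=.
    have /eqP -> : t == i by rewrite -(descends_lambda hN).
    by rewrite dfwith_in.
  rewrite (_ : restrict_child (exist _ (node l) _) _ = jj) //.
  apply/ffunP => -[t lt]; rewrite !ffunE dfwith_out.
    exact: (extend_belowE k0 jj (exist _ t lt)).
  by rewrite -val_eqE /= ltn_eqF // -li -(descends_node hN).
by apply: memv_suml => s _; apply: memvZ; exact: w_in s (exist _ _ _).
Qed.

Lemma slice_in_tree (i : 'I_N) j : slice i j \in U (node i).
Proof.
have [m im] := ubnP i; elim: m => // m IHm in i im j *.
have [i0 | i_gt0] := posnP i.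
  have ei : i = Ordinal hN by apply: val_inj.
  rewrite ei (_ : slice _ _ = to_root_block T psi) //.
  apply/ffunP => jj; rewrite !ffunE splice0; congr (psi _).
  apply/ffunP => l; rewrite [RHS]ffunE.
  exact: (extend_belowE k0 jj (root_leaf T l)).
have lti : (i.-1 < N)%N by apply: leq_ltn_trans (leq_pred i) (ltn_ord i).
apply: (@slice_succ (Ordinal lti)) => [|j']; first by rewrite /= prednK.
by apply: IHm; rewrite /= -ltnS prednK.
Qed.

(** Each row of the flattening is a slice, so expansion in a basis of [U (node i)] factors the
    matrix through that dimension. *)
Lemma rank_flattening_tree (i : 'I_N) :
  (\rank (flattening psi i) <= \dim (U (node i)))%N.
Proof.
pose X := vbasis (U (node i)).
have -> : flattening psi i =
    \matrix_(p, a) coord X a (slice i (enum_val p)) *m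
    \matrix_(a, q) X`_a (restrict_below (node i) (enum_val q)).
  apply/matrixP => p q; rewrite !mxE -sliceE.
  rewrite {1}(coord_vbasis (slice_in_tree i (enum_val p))) sum_ffunE.
  by apply: eq_bigr => a _; rewrite !mxE ffunE.
exact: mulmx_max_rank.
Qed.

End TreeToFlattenings.

Lemma tree_bounded_flattenings (hN : (0 < N)%N) (k0 : multi_index d) psi :
  r ord0 = 1%N -> r ord_max = 1%N ->
  (exists U : forall v : train_tree hN,
     {vspace tensor K (fun l : leaf_below v => d (val l))},
   [/\ forall v, (\dim (U v) <= rank_at (train_rank d r) v)%N,
       forall v, ~~ is_leaf v ->
         forall phi, phi \in U v -> in_tensor_product U phi
     & to_root_block (train_tree hN) psi \in U (Defs.root (train_tree hN))]) ->
  bounded_flattenings psi.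
Proof.
move=> r0 rN [U [dimU U_tensor psi_root]] m.
(* No node lies to the right of the bond N; there the rank is at most 1, the value of [r] at
   [ord_max]. *)
have [mN | ltmN] : m = N :> nat \/ (m < N)%N.
  by have := ltn_ord m; rewrite ltnS leq_eqVlt => /orP[/eqP|]; [left | right].
  rewrite mN (_ : m = ord_max) ?rN ?rank_flattening_last //; exact: val_inj.
have -> : m = bondl (Ordinal ltmN) by apply: val_inj.
apply: leq_trans (rank_flattening_tree k0 U_tensor psi_root _) _.
by rewrite -(rank_at_node hN d r0).
Qed.

(** * Tensor trains from rank bounds *)

Section FlatteningsToTrain.
Hypotheses (d_gt0 : forall i, (0 < d i)%N) (r_gt0 : forall m, (0 < r m)%N).
Hypotheses (N_gt0 : (0 < N)%N) (r0 : r ord0 = 1%N) (rN : r ord_max = 1%N).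
Variable psi : tensor K d.
Hypothesis psi_bounded : bounded_flattenings psi.

(* For 0 < m < N, b spans the row space of the flattening at m; at the two ends
   it is normalised so that the contraction of the whole train is psi. *)
Lemma bond_basis (m : 'I_N.+1) : exists b : 'I_(r m) -> multi_index d -> K,
  [/\ (0 < m)%N -> forall j, exists c,
        forall k, psi (splice m j k) = \sum_a c a * b a k,
      (m < N)%N -> forall a, exists c : 'I_#|{: multi_index d}| -> K,
        forall k, b a k = \sum_p c p * psi (splice m (enum_val p) k),
      m = 0%N :> nat -> forall a k, b a k = psi k
    & m = N :> nat -> forall a k, b a k = 1].
Proof.
have [m0 | m_gt0] := posnP m.
  exists (fun _ k => psi k); rewrite m0; split=> // [_ _ | N0]; last first.
    by have := congr1 (leq 1) N0; rewrite N_gt0.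
  (* At the bond 0 every row of the flattening is [psi]; the row of [k0] is taken with coefficient
     1. *)
  pose k0 : multi_index d := [ffun i => Ordinal (d_gt0 i)].
  exists (fun p => (p == enum_rank k0)%:R) => k.
  rewrite (bigD1 (enum_rank k0)) //= eqxx mul1r splice0 big1 ?addr0 //.
  by move=> p /negbTE ->; rewrite mul0r.
have [mN | ltmN] : m = N :> nat \/ (m < N)%N.
  by have := ltn_ord m; rewrite ltnS leq_eqVlt => /orP[/eqP|]; [left | right].
  exists (fun _ _ => 1); rewrite mN; split=> // [_ j||N0].
    (* The last bond has a single value and [b] is 1 there, so the coefficient is the entry of [psi]
       at [j]. *)
    exists (fun _ => psi j) => k; rewrite splice_last.
    have -> : m = ord_max by apply: val_inj.
    by rewrite sumr_const card_ord rN mulr1.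
    by rewrite ltnn.
  by have := congr1 (leq 1) N0; rewrite N_gt0.
(* [C] writes the rows of [B] in those of the flattening, and [D] does the reverse. *)
have [B /eqmxP/andP[/submxP[C BC] /submxP[D MD]]] :=
  rank_le_spanning_rows (psi_bounded m).
exists (fun a k => B a (enum_rank k)); split.
- move=> _ j; exists (D (enum_rank j)) => k.
  have /matrixP/(_ (enum_rank j) (enum_rank k)) := MD.
  by rewrite !mxE !enum_rankK.
- move=> _ a; exists (C a) => k.
  have /matrixP/(_ a (enum_rank k)) -> := BC.
  by rewrite mxE; apply: eq_bigr => p _; rewrite mxE enum_rankK.
- by move=> m0; rewrite m0 in m_gt0.
- by move=> mN; rewrite mN ltnn in ltmN.
Qed.

(** With the index of site i fixed to [x], a row of the flattening at i becomes a row of the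
    flattening at i + 1. Hence [b] at the bond i expands over [b] at the bond i + 1; the
    coefficients form the core at site i, and [b] obeys the recursion of the right contractions. *)
Lemma bounded_flattenings_train : exists A : tt_cores K d r, psi = tt_tensor A.
Proof.
have [b bP] := fin_all_exists bond_basis.
have core (i : 'I_N) (x : 'I_(d i)) (a : 'I_(r (bondl i))) :
    exists e : 'I_(r (bondr i)) -> K,
    forall k, k i = x -> b _ a k = \sum_c e c * b _ c k.
  have [_ /(_ (ltn_ord i) a)[c cP] _ _] := bP (bondl i).
  have [b_span _ _ _] := bP (bondr i).
  have /fin_all_exists[c' c'P] (p : 'I_#|{: multi_index d}|) : exists e,
      forall k, psi (splice i.+1 (update (enum_val p) x) k) =
                \sum_s e s * b (bondr i) s k.
    exact: b_span.
  exists (fun s => \sum_p c p * c' p s) => k kx.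
  rewrite cP; under [RHS]eq_bigr do rewrite mulr_suml.
  rewrite exchange_big; apply: eq_bigr => p _.
  rewrite -{1}(update_id k i) kx -splice_succ.
  rewrite c'P mulr_sumr.
  by apply: eq_bigr => s _; rewrite mulrA.
have [A AP] := fin_all_exists (fun i =>
  fin_all_exists (fun x => fin_all_exists (core i x))).
exists (fun i x c a => A i x a c).
pose z : multi_index r := [ffun m => Ordinal (r_gt0 m)].
apply/ffunP => k.
rewrite -(right_contraction_first _ z (Ordinal (r_gt0 ord0)) k r0).
rewrite -(@right_contraction_unique _ _ _ _ _ z b).
- by have [_ _ -> //] := bP ord0.
- by have [_ _ _ b_last] := bP ord_max; apply: b_last.
- by move=> i a k'; apply: AP.
Qed.

End FlatteningsToTrain.

(** The equations are the minors of size [(r m).+1] of the flattenings, as homogeneous polynomials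
    in the coordinates of the tensor. *)
Lemma bounded_flattenings_closed :
  zariski_closed (projectivization bounded_flattenings).
Proof.
pose minor m s (f g : 'I_s -> 'I_#|{: multi_index d}|) :=
  generic_det K (fun p q => splice m (enum_val (f p)) (enum_val (g q))).
have minorE m s f g psi :
    poly_value (minor m s f g) psi = \det (mxsub f g (flattening psi m)).
  by rewrite generic_detE; congr (\det _); apply/matrixP => p q; rewrite !mxE.
exists [set P | exists (m : 'I_N.+1) f g, P = minor m (r m).+1 f g]%classic.
split; first by move=> _ [m [f [g ->]]]; exists (r m).+1; apply: generic_det_homog.
apply/seteqP; split=> x /=.
  move=> [psi [[psi_neq0 psi_x] psi_b]] _ [m [f [g ->]]] phi [_ phi_x].
  (* The class is a line, so any representative is a multiple of [psi] and its flattenings have no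
     larger rank. *)
  have [c ->] : exists c, phi = c *: psi.
    apply/vlineP; suff -> : <[psi]>%VS = val x by [].
    by apply/eqP; rewrite eqEdim -memvE psi_x (eqP (valP x)) dim_vline psi_neq0.
  rewrite minorE flatteningZ; apply: (rank_leP _ _).1.
  exact: leq_trans (mxrankS (scalemx_sub _ (submx_refl _))) (psi_b m).
move=> x_zero; pose psi := vpick (val x).
have psi_x : represents psi x.
  by split; rewrite ?memv_pick // vpick0 -dimv_eq0 (eqP (valP x)).
exists psi; split=> // m; apply/rank_leP => f g; rewrite -minorE.
by apply: x_zero => //; exists m, f, g.
Qed.

End Flattenings.

Theorem proposition2p7 (R : realType) (N : nat) (hN : (1 < N)%N)
  (d : 'I_N -> nat) (r : 'I_N.+1 -> nat)
  (hd : forall i, (0 < d i)%N) (hr : forall i, (0 < r i)%N)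
  (hr0 : r ord0 = 1%N) (hrN : r ord_max = 1%N) :
  TT R[i] d r = TTN R[i] (train_tree (ltnW hN)) d (train_rank d r).
Proof.
pose k0 : multi_index d := [ffun i => Ordinal (hd i)].
pose z : multi_index r := [ffun m => Ordinal (hr m)].
pose F := projectivization (@bounded_flattenings R[i] N d r).
have TTN_F : (TTN R[i] (train_tree (ltnW hN)) d (train_rank d r) `<=` F)%classic.
  move=> x [psi [psi_x psi_tree]]; exists psi; split=> //.
  exact: tree_bounded_flattenings psi_tree.
have train_TTN A psi x : represents psi x -> psi = @tt_tensor R[i] N d r A ->
    TTN R[i] (train_tree (ltnW hN)) d (train_rank d r) x.
  by move=> psi_x psiA; exists psi; split=> //; rewrite psiA; apply: tt_tensor_tree.
apply/seteqP; split=> x.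
  (* The closure lies in every closed set containing the trains, and [F] is one. *)
  move/(_ F) => xF; have [] : F x.
    apply: xF; split; first exact: bounded_flattenings_closed.
    by move=> y [psi [psi_y [A psiA]]]; apply/TTN_F/train_TTN/psiA.
  move=> psi [psi_x /(bounded_flattenings_train hd hr (ltnW hN) hr0 hrN)[A psiA]].
  exact: train_TTN psi_x psiA.
(* A point of the tree variety is a train itself, so it lies in every closed [Z] of the
   intersection. *)
move=> /TTN_F[psi [psi_x]].
move=> /(bounded_flattenings_train hd hr (ltnW hN) hr0 hrN)[A psiA] Z [_]; apply.
by exists psi; split=> //; exists A.
Qed.
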